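(* Let $X$ be an infinite regular cardinal, let $p:X^2\to X$ be any injection whose range does not contain $0$, and let $p_\Delta:X^2\to X$ be given by $p_\Delta(x_1,x_2)=p(x_1,x_2)$ if $x_2<x_1$ and $p_\Delta(x_1,x_2)=0$ otherwise. Then $Pol(T_1)=\langle\{\mathrm{med}_3,p_\Delta\}\cup\mathscr{O}^{(1)}\rangle$. In particular, $Pol(T_1)$ is finitely generated over the unary functions, i.e. there is a finite set $\mathscr{F}\subseteq\mathscr{O}$ with $Pol(T_1)=\langle\mathscr{F}\cup\mathscr{O}^{(1)}\rangle$.
   Context: $X$ is an infinite regular cardinal with its usual well-order; $0$ is its smallest element. $\mathscr{O}^{(n)}$ is the set of all functions $X^n\to X$ and $\mathscr{O}=\bigcup_{n\ge 1}\mathscr{O}^{(n)}$. A clone over $X$ is a subset of $\mathscr{O}$ containing all projections and closed under composition. For $\mathscr{F}\subseteq\mathscr{O}$, $\langle\mathscr{F}\rangle$ is the smallest clone containing $\mathscr{F}$. A function $f\in\mathscr{O}^{(n)}$ is almost unary iff there are $F\in\mathscr{O}^{(1)}$ and $1\le k\le n$ with $f(x_1,\dots,x_n)<F(x_k)$ for all $(x_1,\dots,x_n)\in X^n$. $T_1$ is the set of all binary almost unary functions. $Pol(T_1)$ is the set of all $f\in\mathscr{O}$ (of any arity $n$) such that for all $g_1,\dots,g_n\in T_1$ the composite $f(g_1,\dots,g_n)$ is in $T_1$. $\mathrm{med}_3(x_1,x_2,x_3)=x_{j_2}$ if $x_{j_1}\le x_{j_2}\le x_{j_3}$ with $\{j_1,j_2,j_3\}=\{1,2,3\}$.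 *)

(* Defs.v *)
From HB Require Import structures.
From mathcomp Require Import all_boot all_order.
From mathcomp Require Import all_classical.
From mathcomp Require Import wochoice.

Set Implicit Arguments.
Unset Strict Implicit.
Unset Printing Implicit Defensive.

Import Order.TTheory.

Local Open Scope classical_set_scope.
Local Open Scope card_scope.
Local Open Scope order_scope.

(* A cardinal is an initial ordinal, i.e. a well-order that has no injection
   into a proper initial segment.  An ordinal is represented by a well-ordered
   type; the bottom element required by [bOrderType] exists in every nonempty
   well-order and plays the role of 0. *)
Definition infinite_cardinal (d : Order.disp_t) (X : bOrderType d) : Prop :=
  [/\ well_order (<=%O : rel X),
      infinite_set [set: X]
    & forall x : X, ~ ([set: X] #<= [set y | y < x])].

Definition cofinal (d : Order.disp_t) (X : bOrderType d) (A : set X) : Prop :=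
  forall x : X, exists2 a, A a & x <= a.

Definition infinite_regular_cardinal (d : Order.disp_t) (X : bOrderType d) :
    Prop :=
  infinite_cardinal X /\
  forall A : set X, cofinal A -> A #= [set: X].

Definition fn (X : Type) (n : nat) : Type := ('I_n -> X) -> X.

(* The set of all finitary functions of positive arity: the first component
   [n] stands for arity [n.+1]. *)
Definition oper (X : Type) : Type := {n : nat & fn X n.+1}.

Definition op (X : Type) (n : nat) (f : fn X n.+1) : oper X :=
  existT (fun n => fn X n.+1) n f.

Definition unary (X : Type) : set (oper X) := [set op f | f in [set: fn X 1]].
Arguments unary : clear implicits.

Definition proj (X : Type) (n : nat) (k : 'I_n) : fn X n := fun x => x k.

Definition fcomp (X : Type) (n m : nat) (f : fn X n) (g : 'I_n -> fn X m) :
    fn X m :=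
  fun x => f (fun i => g i x).

Definition is_clone (X : Type) (C : set (oper X)) : Prop :=
  (forall (n : nat) (k : 'I_n.+1), C (op (@proj X _ k))) /\
  (forall (n m : nat) (f : fn X n.+1) (g : 'I_n.+1 -> fn X m.+1),
     C (op f) -> (forall i, C (op (g i))) -> C (op (fcomp f g))).

Definition clone_generated (X : Type) (F : set (oper X)) : set (oper X) :=
  smallest (@is_clone X) F.

Definition almost_unary (d : Order.disp_t) (X : bOrderType d) (n : nat)
    (f : fn X n) : Prop :=
  exists (F : X -> X) (k : 'I_n), forall x : 'I_n -> X, f x < F (x k).

Definition T1 (d : Order.disp_t) (X : bOrderType d) : set (fn X 2) :=
  [set f | almost_unary f].
Arguments T1 {d} X.

Definition Pol (X : Type) (m : nat) (T : set (fn X m)) : set (oper X) :=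
  [set f | forall g : 'I_(projT1 f).+1 -> fn X m,
     (forall i, T (g i)) -> T (fcomp (projT2 f : fn X (projT1 f).+1) g)].

Definition is_median (d : Order.disp_t) (X : bOrderType d) (x : 'I_3 -> X)
    (j2 : 'I_3) : bool :=
  [exists j1, exists j3, uniq [:: j1; j2; j3] && (x j1 <= x j2 <= x j3)].

(* The default value of [odflt] is never used, see [is_median_exists]. *)
Definition med3 (d : Order.disp_t) (X : bOrderType d) : fn X 3 :=
  fun x => x (odflt ord0 [pick j | is_median x j]).
Arguments med3 {d} X.

Definition p_Delta (d : Order.disp_t) (X : bOrderType d) (p : fn X 2) :
    fn X 2 :=
  fun x => if x ord_max < x ord0 then p x else \bot.

Lemma is_median_exists (d : Order.disp_t) (X : bOrderType d) (x : 'I_3 -> X) :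
  exists j, is_median x j.
Proof.
have [i0 i1 i2] : [/\ 0 < 3, 1 < 3 & 2 < 3]%N by [].
pose a := Ordinal i0; pose b := Ordinal i1; pose c := Ordinal i2.
have M j1 j2 j3 : uniq [:: j1; j2; j3] -> x j1 <= x j2 -> x j2 <= x j3 ->
    exists j, is_median x j.
  move=> u h1 h2; exists j2; apply/existsP; exists j1; apply/existsP.
  by exists j3; rewrite u h1 h2.
have [ab|/ltW ab] := leP (x a) (x b); have [bc|/ltW bc] := leP (x b) (x c);
  have [ac|/ltW ac] := leP (x a) (x c).
- exact: (M a b c).
- exact: (M a b c).
- exact: (M a c b).
- exact: (M c a b).
- exact: (M b a c).
- exact: (M b c a).
- exact: (M c b a).
- exact: (M c b a).
Qed.

Lemma med3E (d : Order.disp_t) (X : bOrderType d) (x : 'I_3 -> X)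
    (j1 j2 j3 : 'I_3) :
  uniq [:: j1; j2; j3] -> x j1 <= x j2 -> x j2 <= x j3 -> med3 X x = x j2.
Proof.
move=> u h12 h23; rewrite /med3; case: pickP => [j|H] /=; last first.
  by have [j] := is_median_exists x; rewrite H.
move=> /existsP[k1 /existsP[k3 /and3P[v g1 g3]]].
have full (a b c : 'I_3) : uniq [:: a; b; c] -> forall i, i \in [:: a; b; c].
  move=> w i; have := uniq_min_size (s1 := [:: a; b; c]) (s2 := enum 'I_3) w.
  rewrite size_enum_ord => /(_ _ isT)[z _|_ E]; first by rewrite mem_enum.
  by rewrite E mem_enum.
have := full _ _ _ u j; rewrite !inE => /or3P[]/eqP E; last 2 first.
- by rewrite E.
- apply/le_anti; rewrite E h23 andbT; rewrite E in v g1 g3.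
  have := full _ _ _ v j2; rewrite !inE => /or3P[]/eqP E2.
  + have := full _ _ _ v j1; rewrite !inE => /or3P[]/eqP E1.
    * by move: u; rewrite E1 E2 /= inE eqxx.
    * by move: u; rewrite E1 /= !inE eqxx orbT.
    * by rewrite (le_trans g3) // -E1.
  + by move: u; rewrite E2 /= !inE eqxx /= andbF.
  + by rewrite E2.
- apply/le_anti; rewrite E h12 /=; rewrite E in v g1 g3.
  have := full _ _ _ v j2; rewrite !inE => /or3P[]/eqP E2.
  + by rewrite E2.
  + by move: u; rewrite E2 /= !inE eqxx.
  + have := full _ _ _ v j3; rewrite !inE => /or3P[]/eqP E3.
    * by rewrite (le_trans h23) // E3.
    * by move: u; rewrite E3 /= !inE eqxx orbT.
    * by move: u; rewrite E3 E2 /= !inE eqxx /= andbF.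
Qed.

(* Main.v *)
(** Call a set S of argument positions bounding for f if f stays bounded when
    the arguments in S do.  Then f is in Pol(T_1) iff each S or its complement
    is bounding.  In that case any two non-bounding sets fail to cover the
    positions, so the Baker-Pixley argument gives a median term t that exceeds
    c whenever the arguments at most c lie in a non-bounding set; hence
    f < F o t for a unary F.  Conversely everything below F o t is generated:
    p_Delta(W(a), b) codes the pair (a, b) as soon as W dominates b, so all
    arguments can be coded where a given one is maximal, and the resulting
    pieces of f, being all below F o t, can be coded together with t.
    Only the injectivity of p on {x_2 < x_1} matters, and such a p exists by
    transfinite recursion: regularity makes each final segment equipotent to X
    and leaves room for disjoint successive blocks. *)

Require Import Defs.
From mathcomp Require Import all_boot all_order.
From mathcomp Require Import all_classical.

Set Implicit Arguments.
Unset Strict Implicit.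
Unset Printing Implicit Defensive.

Import Order.TTheory.

Local Open Scope classical_set_scope.
Local Open Scope card_scope.
Local Open Scope order_scope.

(** * Boundedness and recursion in a regular cardinal *)

Section RegularCardinal.
Context (d : Order.disp_t) (X : bOrderType d).
Hypothesis hX : infinite_regular_cardinal X.

Lemma lt_wf : well_founded (fun x y : X => x < y).
Proof.
have [[wo _ _] _] := hX; apply: contrapT => nwf.
have /existsNP[z0 nz0] := nwf.
have [|z [[zA zmin] _]] := wo [pred x | `[< ~ Acc (fun x y => x < y) x >]].
  by exists z0; rewrite inE.
move: zA; rewrite inE => nAz; apply: nAz; constructor => y yz.
apply: contrapT => nAcc; suff /zmin : y \in [pred x | `[< ~ Acc (fun x y => x < y) x >]].
  by rewrite leNgt yz.
by rewrite inE.
Qed.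

(** An unbounded set is cofinal, hence of full cardinality by regularity, whereas no proper initial
    segment is that large. *)
Lemma small_set_bounded (A : set X) (a : X) :
  A #<= [set y | y < a] -> exists b, forall x, A x -> x < b.
Proof.
have [[_ _ small] reg] := hX => Aa; apply: contrapT => nb.
apply: (small a); apply: card_le_trans Aa.
suff /reg : cofinal A by rewrite card_eq_le => /andP[].
move=> x; apply: contrapT => nx; apply: nb; exists x => y Ay.
by rewrite ltNge; apply/negP => xy; apply: nx; exists y.
Qed.

Lemma no_max (v : X) : exists w, v < w.
Proof.
have [[_ inf _] reg] := hX; apply: contrapT => nw.
suff /reg c : cofinal [set v].
  by apply: inf; rewrite -(eq_finite_set c); exact: finite_set1.
move=> x; exists v => //; rewrite leNgt; apply/negP => vx.
by apply: nw; exists x.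
Qed.

Lemma image_bounded (h : X -> X) (a : X) :
  exists b, forall x, x <= a -> h x < b.
Proof.
have [a' aa'] := no_max a.
have [b hb] := @small_set_bounded (h @` [set y | y < a']) a' (card_image_le _ _).
by exists b => x xa; apply: hb; exists x => //=; exact: le_lt_trans aa'.
Qed.

(* By well-founded recursion; regularity keeps the values met so far bounded. *)
Lemma dominating_fun (H : X -> X -> X) (K : X -> X) :
  exists s : X -> X, (forall a, K a < s a) /\
    forall a a', a' < a -> H a' (s a') < s a.
Proof.
pose B a (u : X -> X) := [set b | K a < b /\ forall x, x < a -> u x < b].
(* Recursion supplies values below [a] only; [\bot] fills in the rest. *)
pose ext a (r : forall y, y < a -> X) y :=
  if pselect (y < a) is left h then H y (r y h) else \bot.
pose s := Fix lt_wf (fun=> X) (fun a r => xget \bot (B a (ext a r))).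
have sE a : s a = xget \bot (B a (fun y => if y < a then H y (s y) else \bot)).
  rewrite [LHS]Fix_eq => [|x f g fg]; congr (xget _ (B _ _)); apply/funext => y.
    by rewrite /ext; case: pselect => [->|/negP/negbTE ->].
  by rewrite /ext; case: pselect => // h; rewrite fg.
have sP a : B a (fun y => if y < a then H y (s y) else \bot) (s a).
  rewrite sE; apply: xgetPex.
  have [b hb] := image_bounded (fun y => if y < a then H y (s y) else \bot) a.
  have [w Kw] := no_max (K a).
  exists (Order.max b w); split; first by rewrite lt_max Kw orbT.
  by move=> x /ltW /hb xb; rewrite lt_max xb.
exists s; split=> [a|a a' lt_a]; first by case: (sP a).
by have [_ /(_ a' lt_a)] := sP a; rewrite lt_a.
Qed.

(** * Injections obtained from regularity *)

Lemma homo_lt_inj (s : X -> X) : {homo s : x y / x < y} -> injective s.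
Proof.
by move=> hs x y exy; case: (ltgtP x y) => // /hs; rewrite exy ltxx.
Qed.

(* By regularity a final segment has as many elements as [X]. *)
Lemma inj_above (v : X) : exists j : X -> X, injective j /\ forall x, v <= j x.
Proof.
have [_ reg] := hX.
have /reg/card_esym/card_bijP[j jb] : cofinal [set y | v <= y].
  by move=> x; exists (Order.max v x) => /=; rewrite le_max lexx ?orbT.
exists (fun x => \val (j (SigSub (mem_setT x)))); split.
  by move=> x y /val_inj /(bij_inj jb) /(congr1 val).
by move=> x; have := valP (j (SigSub (mem_setT x))); rewrite inE.
Qed.

(** Row [a] goes injectively into the final segment from [s a], and [s a] lies above all values that
    earlier rows take below the diagonal. *)
Lemma triangle_injection : exists p : fn X 2,
  (forall x : 'I_2 -> X, x ord_max < x ord0 -> p x != \bot) /\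
  (forall x y : 'I_2 -> X, x ord_max < x ord0 -> y ord_max < y ord0 -> p x = p y -> x = y).
Proof.
have /choice[j jP] : forall v, exists j : X -> X, injective j /\ forall x, v <= j x.
  exact: inj_above.
have jinj v := (jP v).1; have jle v := (jP v).2.
have /choice[B BP] : forall av, exists b, forall x, x <= av.1 -> j av.2 x < b.
  by move=> av; exact: image_bounded.
have [s [s0 sP]] := dominating_fun (fun a v => B (a, v)) (fun=> \bot).
exists (fun x : 'I_2 -> X => j (s (x ord0)) (x ord_max)); split=> [x _|x y ltx lty].
  by rewrite -lt0x (lt_le_trans (s0 (x ord0))).
have far a a' b b' : a' < a -> b' < a' -> j (s a') b' < j (s a) b.
  move=> aa' ba'; apply: lt_le_trans (jle _ _); apply: lt_trans (sP _ _ aa').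
  by apply: (BP (a', s a')); exact: ltW.
case: (ltgtP (x ord0) (y ord0)) => [lt0|lt0|e0] e.
- by have := far _ _ (y ord_max) _ lt0 ltx; rewrite e ltxx.
- by have := far _ _ (x ord_max) _ lt0 lty; rewrite e ltxx.
rewrite e0 in e; have e1 := jinj _ _ _ e.
apply/funext => i; case: (unliftP ord0 i) => [k ->|-> //].
by rewrite (_ : lift _ _ = ord_max) //; apply/val_inj; case: k => -[].
Qed.

(** * Bounding sets of positions and preservation of $T_1$ *)

Definition bounded_on (n : nat) (f : fn X n) (S : {set 'I_n}) : Prop :=
  forall a, exists b, forall x : 'I_n -> X,
    (forall i, i \in S -> x i <= a) -> f x < b.

Lemma bounded_onS (n : nat) (f : fn X n) (S S' : {set 'I_n}) :
  S \subset S' -> bounded_on f S -> bounded_on f S'.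
Proof.
move=> /fintype.subsetP SS' fS a; have [b fb] := fS a.
by exists b => x xa; apply: fb => i /SS'; exact: xa.
Qed.

Lemma finite_bound (I : finType) (h : I -> X) : exists b, forall i, h i <= b.
Proof. by exists (\big[Order.max / \bot]_i h i) => i; exact: le_bigmax. Qed.

Lemma almost_unary_fcomp (n : nat) (f : fn X n) (g : 'I_n -> fn X 2)
    (S : {set 'I_n}) (k : 'I_2) (F : 'I_n -> X -> X) :
  bounded_on f S -> (forall i, i \in S -> forall x, g i x < F i (x k)) ->
  almost_unary (fcomp f g).
Proof.
move=> fS gF.
have /choice[G GF] : forall v, exists b, forall i, F i v <= b.
  by move=> v; exact: finite_bound.
have [B fB] := choice fS.
exists (B \o G), k => x; apply: fB => i iS.
exact: le_trans (ltW (gF i iS x)) (GF _ _).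
Qed.

(** Each inner function is bounded through one of its two variables; this choice splits the
    positions into a set and its complement. *)
Lemma bounded_Pol (n : nat) (f : fn X n.+1) :
  (forall S : {set 'I_n.+1}, bounded_on f S \/ bounded_on f (~: S)) ->
  Pol (T1 X) (op f).
Proof.
move=> dic g /= /choice[F /choice[k gF]].
have [fS|fS] := dic [set i | k i == ord0]%SET.
  apply: (almost_unary_fcomp (k := ord0) (F := F) fS) => i.
  by rewrite inE => /eqP <-; exact: gF.
apply: (almost_unary_fcomp (k := ord_max) (F := F) fS) => i.
rewrite !inE => ki; rewrite (_ : ord_max = k i); first exact: gF.
by apply/val_inj; case: (k i) ki => -[|[|]].
Qed.

Lemma bounded1_Pol (n : nat) (f : fn X n.+1) (i : 'I_n.+1) :
  bounded_on f [set i]%SET -> Pol (T1 X) (op f).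
Proof.
move=> fi; apply: bounded_Pol => S.
by case: (boolP (i \in S)) => iS; [left|right]; apply: bounded_onS fi;
   rewrite finset.sub1set ?inE.
Qed.

(* If [f] is unbounded both for small arguments in [S] and for small arguments
   in its complement, the two families of witnesses are merged into functions
   of [T1] whose composite with [f] is unbounded on both axes. *)
Lemma Pol_bounded (n : nat) (f : fn X n.+1) (S : {set 'I_n.+1}) :
  Pol (T1 X) (op f) -> bounded_on f S \/ bounded_on f (~: S).
Proof.
move=> Pf; apply: contrapT => /not_orP[nS nSC].
have witness A : ~ bounded_on f A -> exists (a : X) (u : X -> 'I_n.+1 -> X),
    forall b, (forall i, i \in A -> u b i <= a) /\ b <= f (u b).
  move=> /existsNP[a /forallNP H]; exists a.
  suff /choice : forall b, exists x, (forall i, i \in A -> x i <= a) /\ b <= f x.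
    by case=> u uP; exists u.
  move=> b; have /existsNP[x /not_implyP[xa xb]] := H b.
  by exists x; split=> //; rewrite leNgt; apply/negP.
have [a [u uP]] := witness _ nS; have [a' [u' uP']] := witness _ nSC.
have [sc scP] := choice no_max.
pose g (i : 'I_n.+1) : fn X 2 := fun x =>
  if i \in S then if x ord0 == \bot then u (x ord_max) i else u' (x ord0) i
  else if x ord_max == \bot then u' (x ord0) i else u (x ord_max) i.
have gT1 i : T1 X (g i).
  case: (boolP (i \in S)) => iS.
    exists (fun v => sc (Order.max a (u' v i))), ord0 => x.
    apply: le_lt_trans (scP _); rewrite le_max /g iS.
    by case: ifP => _; rewrite ?lexx ?orbT ?(uP (x ord_max)).1.
  exists (fun v => sc (Order.max a' (u v i))), ord_max => x.
  apply: le_lt_trans (scP _); rewrite le_max /g (negbTE iS).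
  by case: ifP => _; rewrite ?lexx ?orbT ?(uP' (x ord0)).1 ?inE.
have [F [k /= FP]] := Pf g gT1.
pose pt v w (j : 'I_2) : X := if j == ord0 then v else w.
(* [F \bot] bounds the composite on the axis where coordinate [k] is 0. The other coordinate is set
   to [F \bot] itself, nonzero so that [g] reduces to a single family of witnesses. *)
have F0 : F \bot != \bot.
  have := FP (fun=> \bot); apply: contraTneq => /= ->; by rewrite ltx0.
have [k0|k0] := eqVneq k ord0.
  have := FP (pt \bot (F \bot)); rewrite {2}/pt k0 eqxx.
  rewrite /fcomp (_ : (fun i => _) = u (F \bot)); last first.
    by apply/funext => i; rewrite /g /pt /= eqxx (negbTE F0); case: ifP.
  by rewrite ltNge (uP _).2.
have := FP (pt (F \bot) \bot); rewrite {2}/pt (negbTE k0).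
rewrite /fcomp (_ : (fun i => _) = u' (F \bot)); last first.
  by apply/funext => i; rewrite /g /pt /= eqxx (negbTE F0); case: ifP.
by rewrite ltNge (uP' _).2.
Qed.

(** * The generators preserve $T_1$ *)

(** Two positions either include that of the median or lie on both sides of it. The upper bound puts
    [med3] into $Pol(T_1)$, the lower one drives the interpolation argument. *)
Lemma med3_extrema (y : 'I_3 -> X) (j k : 'I_3) : j != k ->
  Order.min (y j) (y k) <= med3 X y <= Order.max (y j) (y k).
Proof.
move=> jk; have [j2 /existsP[j1 /existsP[j3]]] := is_median_exists y.
case/and3P => u le12 le23; rewrite (med3E u le12 le23).
have full i : i \in [:: j1; j2; j3].
  have [||_ ->] := uniq_min_size (s1 := [:: j1; j2; j3]) (s2 := enum 'I_3) u.
  - by move=> l _; rewrite mem_enum.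
  - by rewrite size_enum_ord.
  - by rewrite mem_enum.
rewrite ge_min le_max.
have := full j; have := full k; rewrite !inE.
by case/or3P => /eqP ek; case/or3P => /eqP ej; move: jk;
   rewrite ej ek ?eqxx // ?lexx ?le12 ?le23 ?orbT.
Qed.

Lemma med3_Pol : Pol (T1 X) (op (med3 X)).
Proof.
have two (A : {set 'I_3}) : (1 < #|A|)%N -> bounded_on (med3 X) A.
  case/card_gt1P => j [k [jA kA jk]] a; have [b ab] := no_max a.
  exists b => x xa; apply: le_lt_trans ab.
  have /andP[_ /le_trans] := med3_extrema x jk.
  by apply; rewrite ge_max !xa.
(* Of a set of three positions and its complement, one has at least two elements. *)
apply: bounded_Pol => S; have := finset.cardsC S; rewrite card_ord.
case: (leqP #|S| 1) => [S1|S2]; last by left; apply: two.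
move=> E; right; apply: two.
by rewrite -(ltn_add2l #|S|) E (leq_ltn_trans (n := 2)) // addn1.
Qed.

Lemma unary_Pol (u : fn X 1) : Pol (T1 X) (op u).
Proof.
apply: (bounded1_Pol (i := ord0)) => a.
have [b ub] := image_bounded (fun v => u (fun=> v)) a.
exists b => x xa; rewrite (_ : x = fun=> x ord0).
  by apply: ub; apply: xa; rewrite inE.
by apply/funext => i; rewrite ord1.
Qed.

Definition pair2 (v w : X) : 'I_2 -> X := fun i => if i == ord0 then v else w.

Lemma pair2E (x : 'I_2 -> X) : x = pair2 (x ord0) (x ord_max).
Proof.
apply/funext => i; rewrite /pair2; case: eqVneq => [-> //|i0].
by congr x; apply/val_inj; case: i i0 => -[|[|]].
Qed.

Lemma p_Delta_Pol (p : fn X 2) : Pol (T1 X) (op (p_Delta p)).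
Proof.
have /choice[B pB] : forall v, exists b, forall w, w <= v -> p_Delta p (pair2 v w) < b.
  by move=> v; exact: image_bounded.
have [sc scP] := choice no_max.
(* The first argument alone bounds the value: [B] does so on and below the diagonal, and above it
   the value is 0. *)
apply: (bounded1_Pol (i := ord0)) => a.
have [b bB] := image_bounded (fun v => Order.max (B v) (sc \bot)) a.
exists b => x xa; have /xa x0a : ord0 \in [set ord0 : 'I_2]%SET by rewrite inE.
apply: lt_trans (bB _ x0a); rewrite lt_max.
have [le10|lt01] := leP (x ord_max) (x ord0).
  by rewrite [x in p_Delta p x]pair2E pB.
by rewrite /p_Delta (lt_gtF lt01) scP orbT.
Qed.

Lemma Pol_clone (m : nat) (T : set (fn X m)) : is_clone (Pol T).
Proof.
split=> [n k g gT|n m' f g Pf Pg h hT]; first exact: gT.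
by apply: (Pf (fun i => fcomp (g i) h)) => i; exact: Pg.
Qed.

(** * Median terms dominating the functions of $Pol(T_1)$ *)

Section Clone.
Variable C : set (oper X).
Hypotheses (cloneC : is_clone C) (unaryC : unary X `<=` C).

Lemma clone_unary (n : nat) (u : X -> X) (a : fn X n.+1) :
  C (op a) -> C (op (fun x => u (a x))).
Proof.
move=> Ca; have [_ comp] := cloneC.
by apply: (comp _ _ (fun y : 'I_1 -> X => u (y ord0)) (fun=> a)) => //;
   apply: unaryC; eexists.
Qed.

Lemma clone_binary (n : nat) (q : fn X 2) (a b : fn X n.+1) :
  C (op q) -> C (op a) -> C (op b) ->
  C (op (fun x => q (pair2 (a x) (b x)))).
Proof.
move=> Cq Ca Cb; have [_ comp] := cloneC.
have H := comp _ _ q (fun i => if i == ord0 then a else b) Cq.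
rewrite (_ : (fun x => _) = fun x => q (fun i => (if i == ord0 then a else b) x)).
  by apply: H => i; case: ifP.
by apply/funext => x; congr q; apply/funext => i; rewrite /pair2; case: ifP.
Qed.

(** Equivalently, for every [x] some position outside [S] carries a value at most [t x]. *)
Definition avoids (n : nat) (t : fn X n) (S : {set 'I_n}) : Prop :=
  forall (x : 'I_n -> X) (c : X), (forall i, x i <= c -> i \in S) -> c < t x.

Lemma avoids_proj (n : nat) (S : {set 'I_n}) (i : 'I_n) :
  i \notin S -> avoids (@Defs.proj X n i) S.
Proof. by move=> iS x c H; rewrite ltNge; apply: contra iS; exact: H. Qed.

(* The interpolation argument of Baker and Pixley: a median of three terms
   avoids every set avoided by two of them. *)
Lemma avoiding_term (n : nat) (E : seq {set 'I_n.+1}) :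
  C (op (med3 X)) -> {in E &, forall S S', S :|: S' != [set: _]%SET} ->
  exists2 t : fn X n.+1, C (op t) & {in E, forall S, avoids t S}.
Proof.
move=> Cmed; have [Cproj Ccomp] := cloneC.
have [m] := ubnP (size E); elim: m E => // m IH E.
have base S S' : S :|: S' != [set: 'I_n.+1]%SET ->
    exists2 t, C (op t) & {in [:: S; S'], forall S, avoids t S}.
  rewrite finset.eqEsubset finset.subsetT /= => /fintype.subsetPn[i _].
  rewrite inE negb_or => /andP[iS iS']; exists (@Defs.proj X _ i); first exact: Cproj.
  by move=> A; rewrite !inE => /orP[]/eqP ->; apply: avoids_proj.
case: E => [|S1 [|S2 [|S3 E]]] sizeE EP.
- by exists (@Defs.proj X _ ord0); first exact: Cproj.
- have [t Ct tE] := base S1 S1 (EP _ _ (mem_head _ _) (mem_head _ _)).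
  by exists t => // S; rewrite inE => SS; apply: tE; rewrite !inE SS.
- by apply: base; apply: EP; rewrite !inE eqxx ?orbT.
have sub F : {subset F <= [:: S1, S2, S3 & E]} -> (size F < m)%N ->
    exists2 t : fn X n.+1, C (op t) & {in F, forall S, avoids t S}.
  by move=> sF szF; apply: IH => // A B /sF AE /sF BE; apply: EP.
(* Each of the three terms drops one of [S1], [S2], [S3], so every set of the list is still avoided
   by at least two of them. *)
have [|//|t1 C1 H1] := sub [:: S2, S3 & E].
  by move=> A; rewrite !inE => /or3P[]->; rewrite ?orbT.
have [|//|t2 C2 H2] := sub [:: S1, S3 & E].
  by move=> A; rewrite !inE => /or3P[]->; rewrite ?orbT.
have [|//|t3 C3 H3] := sub [:: S1, S2 & E].
  by move=> A; rewrite !inE => /or3P[]->; rewrite ?orbT.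
pose ts (i : 'I_3) : fn X n.+1 := nth t3 [:: t1; t2] i.
exists (fcomp (med3 X) ts); first by apply: Ccomp => // -[[|[|[|]]]].
have two (j k : 'I_3) A : j != k -> avoids (ts j) A -> avoids (ts k) A ->
    avoids (fcomp (med3 X) ts) A.
  move=> jk Hj Hk x c xc; have /andP[+ _] := med3_extrema (ts^~ x) jk.
  by apply: lt_le_trans; rewrite lt_min Hj // Hk.
move=> A; rewrite !inE => /or4P[AS|AS|AS|AS].
- by apply: (two (inord 1) (inord 2)); rewrite /ts -?val_eqE /= ?inordK //=;
     [apply: H2|apply: H3]; rewrite !inE AS.
- by apply: (two (inord 0) (inord 2)); rewrite /ts -?val_eqE /= ?inordK //=;
     [apply: H1|apply: H3]; rewrite !inE AS ?orbT.
- by apply: (two (inord 0) (inord 1)); rewrite /ts -?val_eqE /= ?inordK //=;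
     [apply: H1|apply: H2]; rewrite !inE AS ?orbT.
- by apply: (two (inord 0) (inord 1)); rewrite /ts -?val_eqE /= ?inordK //=;
     [apply: H1|apply: H2]; rewrite !inE AS ?orbT.
Qed.

(** If [t x = c], the positions with arguments at most [c] form a bounding set, as [t x] would
    otherwise exceed [c]. There are finitely many such sets, so [f] is bounded on each fibre of
    [t]. *)
Lemma Pol_below_term (n : nat) (f : fn X n.+1) :
  C (op (med3 X)) -> Pol (T1 X) (op f) ->
  exists2 t : fn X n.+1, C (op t) & exists F : X -> X, forall x, f x < F (t x).
Proof.
move=> Cmed Pf.
pose E := [seq S <- enum {set 'I_n.+1} | `[< ~ bounded_on f S >]].
have inE' S : S \in E <-> ~ bounded_on f S.
  by rewrite mem_filter mem_enum andbT; split => /asboolP.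
have [|t Ct tE] := avoiding_term (E := E) Cmed.
  move=> S S' /inE' nS /inE' nS'; apply/negP => /eqP SS'.
  have [//|fSC] := Pol_bounded S Pf; apply: nS'; apply: bounded_onS fSC.
  apply/fintype.subsetP => i; rewrite inE => iS; have := finset.in_setT i.
  by rewrite -SS' inE (negbTE iS).
exists t => //.
suff /choice[F FP] : forall c, exists b, forall x, t x = c -> f x < b.
  by exists F => x; exact: FP.
move=> c.
have /choice[B BP] : forall S, exists b, bounded_on f S ->
    forall x : 'I_n.+1 -> X, (forall i, i \in S -> x i <= c) -> f x < b.
  move=> S; have [fS|nS] := pselect (bounded_on f S); last by exists c.
  by have [b fb] := fS c; exists b.
have [b Bb] := finite_bound B.
exists b => x tx; apply: lt_le_trans (Bb [set i | x i <= c]%SET).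
apply: BP => [|i]; last by rewrite inE.
apply: contrapT => /inE'/tE /(_ x c); rewrite tx ltxx => H.
by have : false by apply: H => i; rewrite inE.
Qed.

(** * Coding tuples with [p_Delta] *)

Section Triangle.
Variable p : fn X 2.
Hypothesis p_neq0 : forall x : 'I_2 -> X, x ord_max < x ord0 -> p x != \bot.
Hypothesis p_inj : forall x y : 'I_2 -> X,
  x ord_max < x ord0 -> y ord_max < y ord0 -> p x = p y -> x = y.
Hypothesis Cp : C (op (p_Delta p)).

Let pD v w := p_Delta p (pair2 v w).

Lemma pD_neq0 v w : (pD v w != \bot) = (w < v).
Proof.
rewrite /pD /p_Delta /=; case: ifP => [wv|]; last by rewrite eqxx.
exact: p_neq0.
Qed.

(** A nonzero common value forces the second pair below the diagonal too. *)
Lemma pD_inj v w v' w' : w < v -> pD v w = pD v' w' -> v = v' /\ w = w'.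
Proof.
move=> wv e; have wv' : w' < v' by rewrite -pD_neq0 -e pD_neq0.
move: e; rewrite /pD /p_Delta /= wv wv' => /p_inj e.
have {}e := e wv wv'.
by split; [have := congr1 (@^~ ord0) e | have := congr1 (@^~ ord_max) e].
Qed.

(** As the clone contains all unary functions, anything determined by the value of one of its
    members belongs to it. *)
Lemma factor_through (T : Type) (e f : T -> X) :
  (forall x y, e x = e y -> f x = f y) -> exists phi, forall x, f x = phi (e x).
Proof.
move=> ef; exists (fun c => xget \bot [set v | exists2 x, e x = c & f x = v]).
move=> x; case: xgetP => [v _ [y exy <-]|/(_ (f x)) []]; last by exists x.
exact: ef.
Qed.

(** Applied to the first argument of [p_Delta], such a [W] moves a pair below the diagonal and keeps
    it decodable. *)
Lemma inj_dominating (K : X -> X) :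
  exists W : X -> X, injective W /\ forall c, K c < W c.
Proof.
have [W [KW Wlt]] := dominating_fun (fun _ s => s) K.
by exists W; split=> //; apply: homo_lt_inj => x y; exact: Wlt.
Qed.

Lemma partial_code (n : nat) (i : 'I_n.+1) (L : seq 'I_n.+1) :
  exists e : fn X n.+1, [/\ C (op e),
    forall x y, e x != \bot -> e x = e y ->
      x i = y i /\ {in L, forall j, x j = y j}
    & forall x : 'I_n.+1 -> X, {in L, forall j, x j <= x i} -> e x != \bot].
Proof.
have [Cproj _] := cloneC; elim: L => [|j L [e [Ce einj e0]]].
  have [s [sinj s0]] := inj_dominating id.
  exists (fun x => s (x i)); split=> [|x y _ /sinj //|x _].
    exact: (clone_unary s (Cproj _ i)).
  by rewrite -lt0x (le_lt_trans _ (s0 _)).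
(* [K] reads [x i] off a nonzero code, so a map dominating [K] lifts the code above every [x j] with
   [x j <= x i]. *)
have [|K KP] := factor_through (e := e) (f := fun x => if e x == \bot then \bot else x i).
  by move=> x y exy; rewrite -exy; case: eqVneq => // ex; case: (einj x y).
have [W' [W'inj KW']] := inj_dominating K.
(* Fixing 0 makes a failed code stay 0, since no [x j] is below 0. *)
pose W c := if c == \bot then \bot else W' c.
exists (fun x => pD (W (e x)) (x j)); split.
- apply: clone_binary Cp _ (Cproj _ j); exact: clone_unary Ce.
- move=> x y; rewrite pD_neq0 => ltx /(pD_inj ltx)[eW exj].
  have ex0 : e x != \bot.
    by apply: contraTneq ltx => ->; rewrite /W eqxx ltx0.
  have exy : e x = e y.
    move: eW; rewrite /W (negbTE ex0); case: eqVneq => [_ e'|_ /W'inj //].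
    by have := KW' (e x); rewrite e' ltx0.
  have [exi exL] := einj x y ex0 exy; split=> // k.
  by rewrite inE => /predU1P[-> //|]; exact: exL.
- move=> x xi; have ex0 : e x != \bot.
    by apply: e0 => k kL; apply: xi; rewrite inE kL orbT.
  rewrite pD_neq0 /W (negbTE ex0); apply: le_lt_trans (KW' _).
  by have := KP x; rewrite (negbTE ex0) => <-; apply: xi; rewrite inE eqxx.
Qed.

Lemma clone_pairing (n : nat) (a b : fn X n.+1) (F : X -> X) :
  C (op a) -> C (op b) -> (forall x, b x < F (a x)) ->
  exists2 c : fn X n.+1, C (op c)
    & forall x y, c x = c y -> a x = a y /\ b x = b y.
Proof.
move=> Ca Cb bF; have [W [Winj FW]] := inj_dominating F.
exists (fun x => pD (W (a x)) (b x)).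
  by apply: clone_binary => //; exact: clone_unary.
move=> x y e; have [|/Winj] := pD_inj _ e; last by [].
exact: lt_trans (FW _).
Qed.

Lemma clone_bounded2 (n : nat) (t g h : fn X n.+1) (F : X -> X)
    (phi : X -> X -> X) :
  C (op t) -> C (op g) -> C (op h) ->
  (forall x, g x < F (t x)) -> (forall x, h x < F (t x)) ->
  C (op (fun x => phi (g x) (h x))).
Proof.
move=> Ct Cg Ch gF hF; have [c Cc cP] := clone_pairing Ct Cg gF.
(* The code of [t] and [g] determines [t], so it also controls [h] and can be paired with it. *)
have [|tau tauP] := factor_through (e := c) (f := t); first by move=> x y /cP[].
have [|c' Cc' cP'] := clone_pairing (F := F \o tau) Cc Ch.
  by move=> x; rewrite /= -tauP.
have [|psi psiP] := factor_through (e := c') (f := fun x => phi (g x) (h x)).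
  by move=> x y /cP'[/cP[_ ->] ->].
by rewrite (funext psiP); exact: clone_unary.
Qed.

(* A function below [F \o t] is glued from its restrictions to the sets where
   a given argument is maximal: there all the other arguments can be coded. *)
Lemma clone_below (n : nat) (t f : fn X n.+1) (F : X -> X) :
  C (op t) -> (forall x, f x < F (t x)) -> C (op f).
Proof.
move=> Ct fF; have [Cproj _] := cloneC.
have /choice[e eP] := fun i => partial_code i (enum 'I_n.+1).
pose f_ L x := if has (fun i => e i x != \bot) L then f x else \bot.
have f_F L x : f_ L x < F (t x).
  by rewrite /f_; case: ifP => // _; exact: le_lt_trans (fF x).
have f1C i : C (op (f_ [:: i])).
  have [Ce einj _] := eP i.
  have [|phi phiP] := factor_through (e := e i) (f := f_ [:: i]).
    move=> x y exy; rewrite /f_ /= -exy orbF; case: ifP => // ex.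
    congr f; apply/funext => j; have [_ ->//] := einj x y ex exy.
    by rewrite mem_enum.
  by rewrite (funext phiP); exact: clone_unary.
have fC L : C (op (f_ L)).
  elim: L => [|i L IH].
    exact: (clone_unary (fun=> \bot) (Cproj _ ord0)).
  (* Testing for 0 is enough: where [e i x] is nonzero but the first piece is 0, [f x] is 0 and so
     is the other piece. *)
  have := clone_bounded2 (fun v w => if v == \bot then w else v)
    Ct (f1C i) IH (f_F _) (f_F _).
  congr (C (op _)); apply/funext => x; rewrite /f_ /= orbF.
  case: (e i x != \bot) => /=; last by rewrite eqxx.
  by case: eqVneq => // ->; case: ifP.
have := fC (enum 'I_n.+1); congr (C (op _)); apply/funext => x; rewrite /f_.
case: ifPn => // /hasPn H.
case: (arg_maxP (P := xpredT) x (i0 := ord0) isT) => i _ xi.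
have [_ _ ei] := eP i; have /ei ei0 : {in enum 'I_n.+1, forall j, x j <= x i}.
  by move=> j _; exact: xi.
by have := H i; rewrite mem_enum ei0 => /(_ isT).
Qed.

End Triangle.
End Clone.

(** * The generating set *)

Lemma Pol_T1_generated (p : fn X 2) :
  (forall x : 'I_2 -> X, x ord_max < x ord0 -> p x != \bot) ->
  (forall x y : 'I_2 -> X,
    x ord_max < x ord0 -> y ord_max < y ord0 -> p x = p y -> x = y) ->
  Pol (T1 X) = clone_generated ([set op (med3 X); op (p_Delta p)] `|` unary X).
Proof.
move=> p0 pinj; apply/seteqP; split; last first.
  apply: smallest_sub; first exact: Pol_clone.
  move=> _ [[->|->]|[u _ <-]].
  - exact: med3_Pol.
  - exact: p_Delta_Pol.
  - exact: unary_Pol.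
move=> [n f] Pf C [cloneC genC].
have Cmed : C (op (med3 X)) by apply: genC; left; left.
have Cp : C (op (p_Delta p)) by apply: genC; left; right.
have Cu : unary X `<=` C by move=> u Uu; apply: genC; right.
have [t Ct [F fF]] := Pol_below_term cloneC Cmed Pf.
exact: (clone_below cloneC Cu p0 pinj Cp Ct fF).
Qed.

End RegularCardinal.

Theorem corollary33 (d : Order.disp_t) (X : bOrderType d)
    (hX : infinite_regular_cardinal X) :
  (forall p : fn X 2, injective p -> ~ range p \bot ->
     Pol (T1 X) = clone_generated ([set op (med3 X); op (p_Delta p)] `|` unary X))
  /\
  (exists F : set (oper X),
     finite_set F /\ Pol (T1 X) = clone_generated (F `|` unary X)).
Proof.
split=> [p pinj p0|].
  apply: (Pol_T1_generated hX) => [x _|x y _ _]; last exact: pinj.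
  by apply/eqP => px; apply: p0; exists x.
have [p [p0 pinj]] := triangle_injection hX.
exists [set op (med3 X); op (p_Delta p)]; split; first exact: finite_set2.
exact: (Pol_T1_generated hX).
Qed.
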